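(* Let $\mathcal T$ be the set of ordered pairs $(a,b)$ of positive integers with $a<b$ for which $9a^2b^2-12(a+b)^2$ is a square. Then $\mathcal T$ equals the set of pairs $(a,b)=2(q,r)=(2q,2r)$, with $q,r\in\mathbb{N}$, for which there exist unique odd, coprime, positive integers $s,t$ such that $$s^2+3t^2+2q^2=6stq\quad\text{and}\quad q\le r=3st-q.$$ Furthermore, if $(a,b)=2(q,r)\in\mathcal T$ and $s,t$ are the corresponding integers, then $ab=2(s^2+3t^2)$ and $a+b=6st$. Moreover, $q$ and $r$ are coprime; in particular, $3\nmid ab$.
   Context: $\mathbb{N}$ denotes the set of strictly positive integers. ''Square'' means the square of an integer. *)

(* Defs.v *)
From mathcomp Require Import all_boot all_order all_algebra.
From mathcomp Require Import boolp classical_sets.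

Set Implicit Arguments.
Unset Strict Implicit.
Unset Printing Implicit Defensive.

Import Order.TTheory GRing.Theory Num.Theory.

Local Open Scope classical_set_scope.
Local Open Scope ring_scope.

Definition is_square (n : int) : Prop := exists m : int, n = m ^+ 2.

(* The integers are signed, so the difference below is the true one and may
   be negative (in which case it is not a square). *)
Definition square_pairs : set (int * int) :=
  [set ab : int * int |
    [/\ 0 < ab.1, 0 < ab.2, ab.1 < ab.2 &
        is_square (9 * ab.1 ^+ 2 * ab.2 ^+ 2 - 12 * (ab.1 + ab.2) ^+ 2)]].

Definition oddz (n : int) : bool := ~~ (2 %| n)%Z.

Definition corresponding (q r s t : int) : Prop :=
  [/\ 0 < s /\ 0 < t,
      oddz s /\ oddz t,
      coprimez s t,
      s ^+ 2 + 3 * t ^+ 2 + 2 * q ^+ 2 = 6 * s * t * q &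
      q <= r /\ r = 3 * s * t - q].

(* Main.v *)
(** If 9a²b² - 12(a+b)² is a square, factoring it as a difference of squares
    gives g, s, t > 0 with s, t coprime, ab = g(s² + 3t²) and a + b = 3gst, so
    that a² + gs² + 3gt² = 3g·a·s·t. This Markov-type equation is invariant
    under the three Vieta involutions, which preserve g. In a solution that none
    of them decreases, the summands A, B, C satisfy (A+B+C)² = 3ABC and each is
    at most the sum of the other two, which forces min(A, B, C) <= 3; the few
    remaining cases leave only g = 2. Uniqueness of (s, t) holds because s² and
    3t² have prescribed sum and product, and s² = 3T² is excluded modulo 4. *)
Require Import Defs.
From mathcomp Require Import all_boot all_order all_algebra.
From mathcomp Require Import boolp classical_sets.
From mathcomp Require Import zify ring.

Set Implicit Arguments.
Unset Strict Implicit.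
Unset Printing Implicit Defensive.

Import Order.TTheory GRing.Theory Num.Theory.

Local Open Scope classical_set_scope.
Local Open Scope ring_scope.

(** * Primes dividing products, squares and quadratic forms *)

Lemma prime_dvdz_mul (p : nat) (x y : int) :
  prime p -> (p %| x * y)%Z -> (p %| x)%Z \/ (p %| y)%Z.
Proof.
move=> pp; rewrite !dvdzE abszM /= Euclid_dvdM // => /orP[]; by [left|right].
Qed.

Lemma prime_dvdz_sqr (p : nat) (x : int) :
  prime p -> (p %| x ^+ 2)%Z -> (p %| x)%Z.
Proof. by move=> pp; rewrite expr2 => /prime_dvdz_mul[]. Qed.

Lemma dvdz_sum_sqr3 (x y : int) :
  (3 %| x ^+ 2 + y ^+ 2)%Z -> (3 %| x)%Z /\ (3 %| y)%Z.
Proof.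
have mod3 (z : int) : exists k e : int, z = 3 * k + e /\ (e = 0 \/ e = 1 \/ e = -1).
  exists ((z + 1) %/ 3)%Z, (((z + 1) %% 3)%Z - 1); lia.
have [k [e [-> he]]] := mod3 x; have [l [f [-> hf]]] := mod3 y.
move=> /dvdzP[m hm]; move: he hf hm.
by move=> [->|[->|->]] [->|[->|->]] hm; lia.
Qed.

(** A factor 3 of [s] propagates: 9 then divides 3t², so 3 divides [t] as well. *)
Lemma not_dvdz3_coprime (s t x : int) :
  coprimez s t -> s ^+ 2 + 3 * t ^+ 2 = 9 * x -> False.
Proof.
move=> cst E.
have /dvdzP[k hk] : (3 %| s)%Z.
  by apply: (@prime_dvdz_sqr 3) => //; apply/dvdzP; exists (3 * x - t ^+ 2); lia.
have d3t : (3 %| t)%Z.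
  apply: (@prime_dvdz_sqr 3) => //; apply/dvdzP; exists (x - k ^+ 2).
  rewrite hk in E; lia.
have : (3 %| gcdz s t)%Z by rewrite dvdz_gcd d3t andbT; apply/dvdzP; exists k.
by move: cst; rewrite coprimezE /gcdz /coprime => /eqP ->.
Qed.

(** * Descent for the Markov-type equation *)

Lemma reduced_min_le3 (A B C : int) : 0 < C -> C <= B -> B <= A -> A <= B + C ->
  (A + B + C) ^+ 2 = 3 * A * B * C -> C <= 3.
Proof.
move=> C0 CB BA ABC E.
(* [h1] bounds A² + B² by 2AB + AC - BC; with [h2] and [h3] this yields (A+B+C)² <= 9AB, to be
   compared with 3ABC. *)
have h1 : (A - B) * (B + C - A) >= 0 by rewrite mulr_ge0 // subr_ge0.
have h2 : C * (B + C) <= A * (2 * B) by apply: ler_pM; lia.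
have h3 : A * C <= A * B by rewrite ler_wpM2l //; lia.
have h4 : (A * B) * C <= (A * B) * 3 by lia.
have AB0 : 0 < A * B by rewrite mulr_gt0 //; lia.
by rewrite ler_pM2l in h4.
Qed.

Lemma reduced_solution_g2 (g a s t : int) : 0 < g -> 0 < a -> 0 < s -> 0 < t ->
  a ^+ 2 + g * s ^+ 2 + 3 * g * t ^+ 2 = 3 * g * a * s * t ->
  2 * a <= 3 * g * s * t -> 2 * s <= 3 * a * t -> 2 * t <= a * s -> g = 2.
Proof.
move=> g0 a0 s0 t0 E ha hs ht.
have sq1 (x : int) : 0 < x -> x ^+ 2 <= 3 -> x = 1 by move=> *; nia.
have caseA : a ^+ 2 <= 3 -> g = 2.
  move=> /(sq1 _ a0) a1; exfalso; rewrite a1 in E.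
  (* Four times the bracket is (2s - 3t)² + 3t² > 0, whereas [E] makes the product equal to -1. *)
  have : g * (s ^+ 2 + 3 * t ^+ 2 - 3 * s * t) > 0.
    apply: mulr_gt0 => //; have := sqr_ge0 (2 * s - 3 * t); have := exprn_gt0 2 t0.
    lia.
  lia.
have caseB : g * s ^+ 2 <= 3 -> g = 2.
  move=> h.
  have s1 : s = 1 by apply: sq1 => //; nia.
  rewrite s1 in h E.
  (* For g = 1 the equation becomes (2a - 3t)² + 3t² = -4; for g = 3 it forces 3 to divide [a], and
     then fails modulo 9. *)
  have [-> //|[g1|g3]] : g = 2 \/ (g = 1 \/ g = 3) by lia.
    exfalso; rewrite g1 in E.
    have := sqr_ge0 (2 * a - 3 * t); have := exprn_gt0 2 t0; lia.
  exfalso; rewrite g3 in E.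
  have /dvdzP[k hk] : (3 %| a)%Z.
    apply: (@prime_dvdz_sqr 3) => //; apply/dvdzP.
    by exists (3 * a * t - 1 - 3 * t ^+ 2); lia.
  rewrite hk in E; lia.
have caseC : 3 * g * t ^+ 2 <= 3 -> g = 2.
  move=> h.
  have t1 : t = 1 by apply: sq1 => //; nia.
  rewrite t1 in h E.
  have g1 : g = 1 by lia.
  exfalso; rewrite g1 in E.
  (* Here a² + s² + 3 = 3as; once 3 divides both [a] and [s], this fails modulo 9. *)
  have [/dvdzP[k hk] /dvdzP[l hl]] : (3 %| a)%Z /\ (3 %| s)%Z.
    by apply: dvdz_sum_sqr3; apply/dvdzP; exists (a * s - 1); lia.
  rewrite hk hl in E; lia.
set A := a ^+ 2 in E caseA; set B := g * s ^+ 2 in E caseB.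
set C := 3 * g * t ^+ 2 in E caseC.
have A0 : 0 < A by apply: exprn_gt0.
have B0 : 0 < B by apply: mulr_gt0 => //; apply: exprn_gt0.
have C0 : 0 < C by apply: mulr_gt0; [lia | apply: exprn_gt0].
have EP : (A + B + C) ^+ 2 = 3 * A * B * C by rewrite E /A /B /C; ring.
(* Multiplied by [a], the bound [ha] reads 2A <= A + B + C by [E]; likewise for the other two. *)
have hA : A <= B + C.
  suff : a * (2 * a) <= a * (3 * g * s * t) by lia.
  by rewrite ler_pM2l.
have hB : B <= A + C.
  suff : g * s * (2 * s) <= g * s * (3 * a * t) by lia.
  by rewrite ler_pM2l // mulr_gt0.
have hC : C <= A + B.
  suff : 3 * g * t * (2 * t) <= 3 * g * t * (a * s) by lia.
  by rewrite ler_pM2l // !mulr_gt0.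
clear E ha hs ht.
have [BA|AB] := leP B A; have [CB|BC] := leP C B; have [CA|AC] := leP C A;
  first [lia
        | by apply: caseC; apply: (@reduced_min_le3 A B C); lia
        | by apply: caseC; apply: (@reduced_min_le3 B A C); lia
        | by apply: caseB; apply: (@reduced_min_le3 A C B); lia
        | by apply: caseB; apply: (@reduced_min_le3 C A B); lia
        | by apply: caseA; apply: (@reduced_min_le3 B C A); lia
        | by apply: caseA; apply: (@reduced_min_le3 C B A); lia].
Qed.

Lemma markov_type_g2 (g a s t : int) : 0 < g -> 0 < a -> 0 < s -> 0 < t ->
  a ^+ 2 + g * s ^+ 2 + 3 * g * t ^+ 2 = 3 * g * a * s * t -> g = 2.
Proof.
move=> g0.
have [n] := ubnP `|(a + s + t)%R|%N.
elim: n a s t => // n IH a s t hn a0 s0 t0 E.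
have s2 := exprn_gt0 2 s0; have t2 := exprn_gt0 2 t0; have a2 := exprn_gt0 2 a0.
have [ha|ha] := leP (2 * a) (3 * g * s * t); last first.
  (* The two roots in [a] have product g(s² + 3t²) > 0, so the conjugate root is positive too; the
     other two involutions work alike. *)
  have p : 0 < 3 * g * s * t - a.
    have gs2 := mulr_gt0 g0 s2; have gt2 := mulr_gt0 g0 t2.
    by rewrite -(pmulr_rgt0 _ a0); lia.
  by apply: (IH (3 * g * s * t - a) s t) => //; lia.
have [hs|hs] := leP (2 * s) (3 * a * t); last first.
  have p : 0 < 3 * a * t - s.
    have gt2 := mulr_gt0 g0 t2.
    by rewrite -(pmulr_rgt0 _ (mulr_gt0 g0 s0)); lia.
  by apply: (IH a (3 * a * t - s) t) => //; lia.
have [ht|ht] := leP (2 * t) (a * s); last first.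
  have p : 0 < a * s - t.
    have gs2 := mulr_gt0 g0 s2.
    by rewrite -(pmulr_rgt0 _ (mulr_gt0 g0 t0)); lia.
  by apply: (IH a s (a * s - t)) => //; lia.
exact: reduced_solution_g2 E ha hs ht.
Qed.

(** * Parametrization by factoring the difference of squares *)

Lemma mul_eq_sqr (u w c : int) : 0 < u -> 0 < w -> 0 < c -> u * w = c ^+ 2 ->
  exists g s t : int, [/\ 0 < g, 0 < s /\ 0 < t, coprimez s t,
    u = g * s ^+ 2 /\ w = g * t ^+ 2 & c = g * s * t].
Proof.
move=> u0 w0 c0 E.
have h0 : 0 < gcdz u c by rewrite lt0r gcdz_eq0 (gt_eqF u0) /=.
(* With h = gcd(u, c), u = sh and c = th, the hypothesis becomes sw = ht². As [s] is coprime to [t],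
   it divides h, and g is h / s. *)
have /dvdzP[s us] := dvdz_gcdl u c; have /dvdzP[t ct] := dvdz_gcdr u c.
have cst : coprimez s t.
  rewrite /coprimez; apply/eqP; apply: (mulIf (lt0r_neq0 h0)).
  rewrite mul1r [RHS](_ : _ = gcdz (s * gcdz u c) (t * gcdz u c)); last first.
    by rewrite -us -ct.
  by rewrite -mulz_gcdl ?ltW // gtz0_abs.
move: us ct h0; set h := gcdz u c => us ct h0.
have s0 : 0 < s by rewrite -(pmulr_lgt0 _ h0) -us.
have t0 : 0 < t by rewrite -(pmulr_lgt0 _ h0) -ct.
have E2 : s * w = h * t ^+ 2.
  by apply: (mulfI (lt0r_neq0 h0)); rewrite us ct in E; lia.
have /dvdzP[g hg] : (s %| h)%Z.
  rewrite -(@Gauss_dvdzl _ _ (t ^+ 2)); first by rewrite -E2 dvdz_mulr.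
  by rewrite coprimezXr.
have g0 : 0 < g by rewrite -(pmulr_lgt0 _ s0) -hg.
exists g, s, t; split=> //.
- split; first by rewrite us hg; ring.
  by apply: (mulfI (lt0r_neq0 s0)); rewrite E2 hg; ring.
- by rewrite ct hg; ring.
Qed.

Lemma square_pair_param (a b : int) : 0 < a -> 0 < b ->
  is_square (9 * a ^+ 2 * b ^+ 2 - 12 * (a + b) ^+ 2) ->
  exists g s t : int, [/\ 0 < g, 0 < s /\ 0 < t, coprimez s t,
    a * b = g * (s ^+ 2 + 3 * t ^+ 2) & a + b = 3 * g * s * t].
Proof.
move=> a0 b0 [m Em].
have /dvdzP[n hn] : (3 %| m)%Z.
  apply: (@prime_dvdz_sqr 3) => //; apply/dvdzP.
  by exists (3 * a ^+ 2 * b ^+ 2 - 4 * (a + b) ^+ 2); lia.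
have /dvdzP[c hc] : (3 %| a + b)%Z.
  apply: (@prime_dvdz_sqr 3) => //; apply/dvdzP.
  exists (a ^+ 2 * b ^+ 2 - n ^+ 2 - (a + b) ^+ 2); rewrite hn in Em; lia.
have c0 : 0 < c by lia.
have En : (a * b - n) * (a * b + n) = 12 * c ^+ 2.
  rewrite hc hn in Em; lia.
(* The factors differ by 2n and have an even product, so both are even; their halves [u] and [v]
   have product 3c² and sum ab. *)
have /dvdzP[u hu] : (2 %| a * b - n)%Z.
  have [||/dvdzP[k hk]] := @prime_dvdz_mul 2 (a * b - n) (a * b + n) isT.
  - by rewrite En; apply/dvdzP; exists (6 * c ^+ 2); lia.
  - by [].
  - by apply/dvdzP; exists (k - n); lia.
pose v := u + n.
have Euv : u * v = 3 * c ^+ 2.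
  have n_eq : a * b = u * 2 + n by lia.
  by rewrite n_eq in En; rewrite /v; lia.
have Suv : a * b = u + v by rewrite /v; lia.
have ab0 := mulr_gt0 a0 b0.
have uv0 : 0 < u * v by rewrite Euv mulr_gt0 // exprn_gt0.
have u0 : 0 < u by nia.
have v0 : 0 < v by nia.
(* Either [u] or [v] may carry the factor 3, so the argument is stated for both orders. *)
have key (x y : int) : 0 < x -> 0 < y -> x * y = 3 * c ^+ 2 -> a * b = x + y ->
    (3 %| y)%Z -> exists g s t : int, [/\ 0 < g, 0 < s /\ 0 < t, coprimez s t,
    a * b = g * (s ^+ 2 + 3 * t ^+ 2) & a + b = 3 * g * s * t].
  move=> x0 y0 Exy Sxy /dvdzP[w hw].
  have w0 : 0 < w by lia.
  have Exw : x * w = c ^+ 2 by rewrite hw in Exy; lia.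
  have [g [s [t [g0 st0 cst [xE wE] cE]]]] := mul_eq_sqr x0 w0 c0 Exw.
  exists g, s, t; split=> //.
  - by rewrite Sxy hw xE wE; ring.
  - by rewrite hc cE; ring.
have [|d|d] := @prime_dvdz_mul 3 u v isT.
- by rewrite Euv dvdz_mulr.
- by apply: (key v u) => //; [rewrite mulrC | rewrite addrC].
- exact: (key u v).
Qed.

(** * Existence, uniqueness and arithmetic of the corresponding integers *)

Lemma corresponding_exists (a b : int) : square_pairs (a, b) ->
  exists q r s t : int, [/\ 0 < q, 0 < r, a = 2 * q, b = 2 * r &
    corresponding q r s t].
Proof.
move=> [/= a0 b0 ab sq].
have [g [s [t [g0 [s0 t0] cst P S]]]] := square_pair_param a0 b0 sq.
(* [a] is a root of X² - (a+b)X + ab, whose coefficients are given by [S] and [P]. *)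
have E : a ^+ 2 + g * s ^+ 2 + 3 * g * t ^+ 2 = 3 * g * a * s * t.
  have : a * (a + b) = a * (3 * g * s * t) by rewrite S.
  lia.
have g2 := markov_type_g2 g0 a0 s0 t0 E; rewrite g2 in P S E.
have /dvdzP[q hq] : (2 %| a)%Z.
  apply: (@prime_dvdz_sqr 2) => //; apply/dvdzP.
  by exists (3 * a * s * t - s ^+ 2 - 3 * t ^+ 2); lia.
have Eq : s ^+ 2 + 3 * t ^+ 2 + 2 * q ^+ 2 = 6 * s * t * q.
  by rewrite hq in E; lia.
have not2 : ~ ((2 %| s)%Z /\ (2 %| t)%Z).
  move=> [ds dt]; have : (2 %| gcdz s t)%Z by rewrite dvdz_gcd ds.
  by move: cst; rewrite coprimezE /gcdz /coprime => /eqP ->.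
(* By [Eq], s² + 3t² is even. *)
have par : (2 %| s)%Z = (2 %| t)%Z.
  apply/idP/idP => /dvdzP[k hk]; apply: (@prime_dvdz_sqr 2) => //; apply/dvdzP.
  - exists (6 * k * t * q - 2 * k ^+ 2 - q ^+ 2 - t ^+ 2); rewrite hk in Eq; lia.
  - exists (6 * s * k * q - 6 * k ^+ 2 - q ^+ 2); rewrite hk in Eq; lia.
exists q, (3 * s * t - q), s, t; split; try lia.
split=> //; last by split=> //; lia.
rewrite /oddz; split; apply/negP => d; apply: not2; split=> //.
- by rewrite -par.
- by rewrite par.
Qed.

Lemma oddzP (s : int) : oddz s -> exists k, s = 2 * k + 1.
Proof. by move=> os; exists (s %/ 2)%Z; rewrite /oddz in os; lia. Qed.

(** As a quadratic in [q], the equation has root sum 3st and root product (s² + 3t²)/2, so [r] is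
    the conjugate root. *)
Lemma corresponding_mul (q r s t : int) : corresponding q r s t ->
  2 * q * r = s ^+ 2 + 3 * t ^+ 2.
Proof. by move=> [_ _ _ E [_ ->]]; lia. Qed.

Lemma corresponding_inj (q r s t s' t' : int) :
  corresponding q r s t -> corresponding q r s' t' -> s = s' /\ t = t'.
Proof.
move=> C C'; have M := corresponding_mul C; have M' := corresponding_mul C'.
case: C C' => [[s0 t0] [os _] _ _ [_ R]] [[s0' t0'] [_ ot'] _ _ [_ R']].
have P : s * t = s' * t' by lia.
(* This is X² - (s'² + 3t'²)X + 3s'²t'² at X = s²; its roots are s'² and 3t'². *)
have : (s - s') * ((s + s') * (s ^+ 2 - 3 * t' ^+ 2)) = 0.
  have -> : (s - s') * ((s + s') * (s ^+ 2 - 3 * t' ^+ 2)) =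
    s ^+ 2 * (s ^+ 2 + 3 * t ^+ 2 - (s' ^+ 2 + 3 * t' ^+ 2))
    + 3 * (s' * t' - s * t) * (s' * t' + s * t) by ring.
  by rewrite -M -M' P !subrr !(mulr0, mul0r, addr0).
move=> /eqP; rewrite !mulf_eq0 => /or3P[|/eqP|/eqP h].
- rewrite subr_eq0 => /eqP ss; split=> //.
  by rewrite ss in P; apply: (mulfI (lt0r_neq0 s0')).
- lia.
- exfalso; have [k hk] := oddzP os; have [l hl] := oddzP ot'.
  rewrite hk hl in h; lia.
Qed.

(** Since q + r = 3st, 3 divides both or neither; if both, 9 divides 2qr = s² + 3t². *)
Lemma corresponding_not_dvd3 (q r s t : int) : corresponding q r s t ->
  ~~ (3 %| q)%Z /\ ~~ (3 %| r)%Z.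
Proof.
move=> C; have M := corresponding_mul C; case: C => _ _ cst _ [_ R].
have no (k : int) : q <> k * 3.
  move=> hk; apply: (@not_dvdz3_coprime s t (2 * k * (s * t - k))) => //.
  rewrite -M R hk; ring.
split; apply/negP => /dvdzP[k hk]; first exact: no hk.
by apply: (no (s * t - k)); lia.
Qed.

(** A common prime divisor of [q] and [r] divides q + r = 3st and 2qr = s² + 3t². It is not 3, so it
    divides [s] or [t], and then both. *)
Lemma corresponding_coprime (q r s t : int) : corresponding q r s t ->
  coprimez q r.
Proof.
move=> C; have M := corresponding_mul C; have [n3q _] := corresponding_not_dvd3 C.
case: C => [[s0 t0] [os ot] cst _ [_ R]].
apply/negPn/negP => ncp.
have [p pp pdiv] : exists2 p : nat, prime p & (p %| gcdz q r)%Z.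
  exists (pdiv (gcdn `|q| `|r|)); last by rewrite dvdzE /gcdz /= pdiv_dvd.
  apply: pdiv_prime; rewrite ltn_neqAle eq_sym.
  rewrite coprimezE /coprime in ncp; rewrite ncp gcdn_gt0.
  (* [q] is nonzero because 3 does not divide it. *)
  by have -> : (0 < `|q|)%N by move: n3q; case: q {M R ncp} => [[]|].
move: pdiv; rewrite dvdz_gcd => /andP[pq pr].
have n3 : ~~ (p %| 3)%Z.
  apply/negP; rewrite dvdzE /= dvdn_prime2 // => /eqP p3.
  by rewrite p3 in pq; rewrite pq in n3q.
have n2 : ~~ (p %| 2)%Z.
  apply/negP; rewrite dvdzE /= dvdn_prime2 // => /eqP p2.
  rewrite p2 in pq pr; move/dvdzP: pq => [k hk]; move/dvdzP: pr => [l hl].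
  have [i hi] := oddzP os; have [j hj] := oddzP ot.
  (* 2qr = s² + 3t² would be divisible by 8, but odd squares are 1 modulo 8. *)
  have [x hx] : exists x, i * (i + 1) = 2 * x.
    by exists ((i * (i + 1)) %/ 2)%Z; have [|] : (i %% 2)%Z = 0 \/ (i %% 2)%Z = 1; nia.
  have [y hy] : exists y, j * (j + 1) = 2 * y.
    by exists ((j * (j + 1)) %/ 2)%Z; have [|] : (j %% 2)%Z = 0 \/ (j %% 2)%Z = 1; nia.
  rewrite hk hl hi hj in M; lia.
have pst : (p %| s * t)%Z.
  have : (p %| 3 * (s * t))%Z.
    by rewrite (_ : 3 * (s * t) = q + r) ?rpredD //; lia.
  by move=> /(prime_dvdz_mul pp)[] // p3; rewrite p3 in n3.
have psum : (p %| s ^+ 2 + 3 * t ^+ 2)%Z by rewrite -M dvdz_mull.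
have [ps pt] : (p %| s)%Z /\ (p %| t)%Z.
  case: (prime_dvdz_mul pp pst) => d; split=> //.
  - have : (p %| 3 * t ^+ 2)%Z.
      by move: psum; rewrite rpredDl // expr2 dvdz_mulr.
    move=> /(prime_dvdz_mul pp)[p3|/prime_dvdz_sqr]; last exact.
    by rewrite p3 in n3.
  - apply: prime_dvdz_sqr => //; move: psum; rewrite rpredDr //.
    by rewrite expr2 !dvdz_mull.
have : (p %| gcdz s t)%Z by rewrite dvdz_gcd ps.
move: cst; rewrite coprimezE /gcdz /coprime => /eqP ->.
by rewrite dvdzE /= dvdn1 => /eqP p1; rewrite p1 in pp.
Qed.

Theorem theorem2 :
  square_pairs =
    [set ab : int * int | exists q r : int,
      [/\ 0 < q, 0 < r, ab = (2 * q, 2 * r) &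
          exists! st : int * int, corresponding q r st.1 st.2]]
  /\
  (forall a b q r : int,
    square_pairs (a, b) -> (a, b) = (2 * q, 2 * r) ->
    [/\ forall s t : int, corresponding q r s t ->
          a * b = 2 * (s ^+ 2 + 3 * t ^+ 2) /\ a + b = 6 * s * t,
        coprimez q r &
        ~~ (3 %| a * b)%Z]).
Proof.
split.
  apply/seteqP; split=> [[a b] /corresponding_exists|[a b] /=].
    move=> [q [r [s [t [q0 r0 -> -> C]]]]].
    exists q, r; split=> //; exists (s, t); split=> // -[s' t'] /= C'.
    by have [-> ->] := corresponding_inj C C'.
  move=> [q [r [q0 r0 [-> ->] [[s t] [/= C _]]]]].
  have M := corresponding_mul C.
  case: C => [[s0 t0] [os ot] _ _ [qr R]].
  split=> /=; try lia.
    have [k hk] := oddzP os; have [l hl] := oddzP ot.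
    (* Equality would give 2q = 3st, which is odd. *)
    have : q <> r by move=> e; rewrite hk hl -e in R; lia.
    lia.
  (* The value is 36((s² + 3t²)² - 12s²t²) = 36(s² - 3t²)². *)
  exists (6 * (s ^+ 2 - 3 * t ^+ 2)).
  transitivity (36 * (2 * q * r) ^+ 2 - 48 * (q + r) ^+ 2); first by ring.
  have -> : q + r = 3 * s * t by lia.
  rewrite M; ring.
move=> a b q r /corresponding_exists[q' [r' [s [t [q0 r0 aE bE C]]]]] [aq br].
have qq : q' = q by lia.
have rr : r' = r by lia.
subst q' r'; split.
- move=> s' t' C'; have M := corresponding_mul C'.
  case: C' => _ _ _ _ [_ R]; rewrite aq br; split; last lia.
  by rewrite -M; ring.
- exact: corresponding_coprime C.
- have [/negP nq /negP nr] := corresponding_not_dvd3 C.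
  apply/negP => /(@prime_dvdz_mul 3 _ _ isT); rewrite aq br.
  by case=> /(@prime_dvdz_mul 3 _ _ isT)[].
Qed.
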